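(* Let $k$ be an algebraically closed field of characteristic $\neq 2$, let $n \geqslant 1$ and $r \geqslant 2$ be integers. Then for $A = (A_0, \ldots, A_r) \in (\mathrm{Symm}_n)^{r+1}$ in general position, the determinantal hypersurface $H_A \subset \mathbb{P}^r$ has only finitely many symmetric presentations up to equivalence. That is, there is a non-empty Zariski open subset $U \subset (\mathrm{Symm}_n)^{r+1}$ such that for every $A \in U$ the set of $B \in (\mathrm{Symm}_n)^{r+1}$ with $H_B = H_A$ is a union of finitely many equivalence classes.
   Context: $\mathrm{Symm}_n$ denotes the space of symmetric $n \times n$ matrices over $k$. For $A = (A_0, \ldots, A_r) \in \mathrm{Symm}_n^{r+1}$ put $P_A(x_0, \ldots, x_r) = \det(x_0 A_0 + x_1 A_1 + \ldots + x_r A_r)$, and let $H_A$ be the hypersurface $P_A = 0$ in $\mathbb{P}^r$. Hypersurfaces of degree $n$ are regarded as given by their defining degree $n$ forms up to a non-zero scalar, so $H_A = H_B$ means $P_A = c\,P_B$ for some $0 \neq c \in k$. A symmetric presentation of $H_A$ is a tuple $B \in \mathrm{Symm}_n^{r+1}$ with $H_B = H_A$. Two tuples $A = (A_0,\ldots,A_r)$ and $B = (B_0, \ldots, B_r)$ in $\mathrm{Symm}_n^{r+1}$ are equivalent if there exists $g \in \mathrm{GL}_n(k)$ such that $B_i = g^t A_i g$ for every $i = 0, 1, \ldots, r$, where $g^t$ is the transpose of $g$. *)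

(* Defs.v *)
From HB Require Import structures.
From mathcomp Require Import all_boot all_order all_algebra.
From mathcomp Require Export mpoly.

Set Implicit Arguments.
Unset Strict Implicit.
Unset Printing Implicit Defensive.

Import GRing.Theory.
Local Open Scope ring_scope.

(* Ambient space of (r+1)-tuples of n x n matrices; (Symm_n)^(r+1) is cut out
   of it by [symm_tuple]. *)
Definition mxtuple (k : fieldType) (n r : nat) : Type :=
  {ffun 'I_r.+1 -> 'M[k]_n}.

Definition symm_tuple (k : fieldType) (n r : nat) (A : mxtuple k n r) : Prop :=
  forall i, (A i)^T = A i.

Definition det_form (k : fieldType) (n r : nat) (A : mxtuple k n r) :
    {mpoly k[r.+1]} :=
  \det (\sum_(i < r.+1) 'X_i *: map_mx (@mpolyC r.+1 k) (A i)).

(* Hypersurfaces are degree n forms up to a nonzero scalar. *)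
Definition same_hypersurface (k : fieldType) (n r : nat)
    (A B : mxtuple k n r) : Prop :=
  exists2 c : k, c != 0 & det_form A = c *: det_form B.

Definition symm_presentation (k : fieldType) (n r : nat)
    (A B : mxtuple k n r) : Prop :=
  symm_tuple B /\ same_hypersurface B A.

Definition tuple_equiv (k : fieldType) (n r : nat)
    (A B : mxtuple k n r) : Prop :=
  exists2 g : 'M[k]_n, g \in unitmx & forall i, B i = g^T *m A i *m g.

(* Polynomial functions on the ambient space have one variable for each entry,
   indexed by a triple (i, a, b) standing for the (a, b) entry of A_i. *)
Definition coord_index (n r : nat) : finType := ('I_r.+1 * 'I_n * 'I_n)%type.

Definition coords (k : fieldType) (n r : nat) (A : mxtuple k n r) :
    'I_#|coord_index n r| -> k :=
  fun t => let: (i, a, b) := enum_val t in A i a b.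

(* Zariski open subsets of (Symm_n)^(r+1): every polynomial function on this
   linear subspace is the restriction of one on the ambient space, so its
   Zariski topology is the subspace topology. The family [S] is arbitrary. *)
Definition zariski_open_symm (k : fieldType) (n r : nat)
    (U : mxtuple k n r -> Prop) : Prop :=
  exists S : {mpoly k[#|coord_index n r|]} -> Prop,
  forall A, U A <-> symm_tuple A /\ exists2 p, S p & p.@[coords A] != 0.

(* Main.v *)
Require Import Defs.
From mathcomp Require Import all_boot all_order all_algebra.
From mathcomp Require Import all_fingroup all_field ring.

(** Let A be general and B a presentation of H_A. The characteristic polynomial
    of B_1 B_0^-1 is that of A_1 A_0^-1, which is separable, so up to equivalence
    B_0 = 1 and B_1 is diagonal. It is then enough that every entry of B_1 and of
    B_i (i >= 2) takes finitely many values. These entries, with the scaling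
    factor det A_0, are unknowns subject to equally many equations
    det A_0 * det (x + y B_1 + z B_i) = det (x A_0 + y A_1 + z A_i), one for each
    chosen point (x, y, z). A dimension count makes each unknown algebraic over
    the left hand sides, hence a root of a nonzero univariate polynomial for
    general A, provided that these left hand sides are algebraically independent.
    For the independence, expand them at a pencil of n tangent lines to a conic,
    i.e. at the diagonal pencil with entries x + l_i y + l_i^2 z, taking as points
    the intersections of two of the tangents, their points of tangency and their
    points on the line z = 0: the leading terms, of order 1 or 2, then form a
    surjective map. *)

Set Implicit Arguments.
Unset Strict Implicit.
Unset Printing Implicit Defensive.

Import GRing.Theory.
Local Open Scope ring_scope.

(** * Multivariate polynomials *)

Lemma poly_eq0_horner (k : closedFieldType) (p : {poly k}) :
  (forall t, p.[t] = 0) -> p = 0.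
Proof.
move=> p0; apply/eqP/negPn/negP => /closed_nonrootP[t].
by rewrite /root p0 eqxx.
Qed.

(** Induction on [n]: [muni] turns [p] into a polynomial in the last variable; one of its
    coefficients is nonzero at some [x], and the last variable then only has to avoid the roots of a
    nonzero univariate polynomial. *)
Lemma meval_neq0 (k : closedFieldType) n (p : {mpoly k[n]}) :
  p != 0 -> exists x, p.@[x] != 0.
Proof.
elim: n p => [|n IHn] p p0.
  exists (fun=> 0); apply: contraNneq p0 => pe.
  have /msize1_polyC pC : (msize p <= 1)%N.
    rewrite msizeE; apply/bigmax_leqP_seq => m _ _.
    by rewrite mdegE big_ord0.
  by rewrite pC mevalC in pe; rewrite pC pe.
have [m0 m0p] : exists m0, m0 \in msupp p.
  by move: p0; rewrite -msupp_eq0; case: (msupp p) => // m s _; exists m; exact: mem_head.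
pose w i := widen_ord (leqnSn n) i : 'I_n.+1.
pose q := (muni p)`_(m0 ord_max).
have {IHn} [|x qx] := IHn q.
  (* No two monomials of [p] with the same last exponent agree in the other exponents, so this
     coefficient survives in [q]. *)
  suff e : q@_[multinom m0 (w i) | i < n] = p@_m0.
    by apply: contraTneq m0p => q0; rewrite mcoeff_msupp -e q0 mcoeff0 eqxx.
  rewrite /q muniE coef_sum raddf_sum /= (bigD1_seq m0) ?msupp_uniq //=.
  rewrite coefZ coefXn eqxx mulr1 mcoeffZ mcoeffX eqxx mulr1 big1 ?addr0 // => m mm0.
  rewrite coefZ coefXn; have [eqm|_] := eqVneq; last by rewrite mulr0 mcoeff0.
  rewrite mulr1 mcoeffZ mcoeffX; case: eqP => [/mnmP eqw|]; last by rewrite mulr0.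
  case/eqP: mm0; apply/mnmP => i; case: (unliftP ord_max i) => [j ->|->] //.
  have := eqw j; rewrite !mnmE => e; rewrite -[lift _ _]/(lift ord_max j).
  suff -> : lift ord_max j = w j by [].
  by apply/val_inj; rewrite /= /bump leqNgt ltn_ord.
have : map_poly (meval x) (muni p) != 0.
  apply: contraNneq qx => /(congr1 (fun f : {poly k} => f`_(m0 ord_max))).
  by rewrite coef_map coef0 /= -/q => ->.
case/closed_nonrootP => t; rewrite /root => pt.
exists (fun i => if unlift ord_max i is Some j then x j else t).
suff <- : (map_poly (meval x) (muni p)).[t] =
   p.@[fun i => if unlift ord_max i is Some j then x j else t] by [].
rewrite muniE rmorph_sum horner_sum mevalE; apply: eq_bigr => m _ /=.
rewrite -mul_polyC rmorphM /= map_polyXn map_polyC /= hornerM hornerXn hornerC.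
rewrite mevalZ mevalX -mulrA; congr (_ * _).
rewrite big_ord_recr /= unlift_none; congr (_ * _).
apply: eq_bigr => j _; rewrite mnmE.
have -> : widen_ord (leqnSn n) j = lift ord_max j.
  by apply/val_inj; rewrite /= /bump leqNgt ltn_ord.
by rewrite liftK.
Qed.

(* [G] has the same lowest power of [t] along the curves [t ^+ wt i * h i] as its
   part [Gd] of least weight, with coefficient [Gd.@[u]]. *)
Lemma meval_lowest_weight (k : closedFieldType) n (wt : 'I_n -> nat)
    (G : {mpoly k[n]}) :
  G != 0 -> exists u : 'I_n -> k, forall h : 'I_n -> {poly k},
    (forall i, (h i).[0] = u i) ->
    exists t, G.@[fun i => t ^+ wt i * (h i).[t]] != 0.
Proof.
move=> G0; pose W (m : 'X_{1..n}) := (\sum_i wt i * m i)%N.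
have [m0 m0G minm0] : exists2 m0, m0 \in msupp G &
    forall m, m \in msupp G -> (W m0 <= W m)%N.
  have [m1 m1G] : exists m1, m1 \in msupp G.
    move: G0; rewrite -msupp_eq0; case: (msupp G) => // m s _.
    by exists m; exact: mem_head.
  have ex : exists d, has (fun m => W m == d) (msupp G).
    by exists (W m1); apply/hasP; exists m1.
  case: (ex_minnP ex) => d /hasP[m0 m0G /eqP <-] mind; exists m0 => // m mG.
  by apply: mind; apply/hasP; exists m.
pose Gd := \sum_(m <- msupp G | W m == W m0) G@_m *: 'X_[m].
have /meval_neq0[u Gu] : Gd != 0.
  apply: contraTneq (m0G) => /(congr1 (mcoeff m0)).
  rewrite mcoeff0 /Gd raddf_sum /= -big_filter.
  rewrite (bigD1_seq m0) ?filter_uniq ?msupp_uniq //=; last first.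
    by rewrite mem_filter eqxx.
  rewrite mcoeffZ mcoeffX eqxx mulr1 big1 ?addr0; last first.
    by move=> m /negPf mm0; rewrite mcoeffZ mcoeffX mm0 mulr0.
  by rewrite mcoeff_msupp => ->; rewrite eqxx.
exists u => h h0.
(* [Q] is [G] along the curve divided by [t ^+ W m0]. Minimality of [W m0] makes the truncated
   subtraction exact, and [Q.[0]] is [Gd.@[u]]. *)
pose Q := \sum_(m <- msupp G)
   G@_m *: ('X^(W m - W m0) * \prod_i (h i) ^+ m i).
have Q0 : Q != 0.
  apply: contraNneq Gu => /(congr1 (fun p : {poly k} => p.[0])).
  rewrite horner0 => <-; rewrite /Q /Gd horner_sum raddf_sum /=.
  rewrite big_mkcond /= big_seq [X in _ == X]big_seq.
  apply/eqP/eq_bigr => m mG; rewrite hornerZ hornerM hornerXn horner_prod.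
  case: eqP => [->|/eqP neq].
    rewrite subnn expr0 mul1r mevalZ mevalX; congr (_ * _).
    by apply: eq_bigr => i _; rewrite horner_exp h0.
  by rewrite expr0n subn_eq0 leqNgt ltn_neqAle eq_sym neq minm0 //= mul0r mulr0.
have : 'X^(W m0) * Q != 0 by rewrite mulf_neq0 // expf_neq0 // polyX_eq0.
case/closed_nonrootP => t; rewrite /root => Xt; exists t.
suff <- : ('X^(W m0) * Q).[t] = G.@[fun i => t ^+ wt i * (h i).[t]] by [].
rewrite hornerM hornerXn horner_sum mulr_sumr mevalE big_seq [RHS]big_seq.
apply: eq_bigr => m mG; rewrite hornerZ hornerM hornerXn horner_prod mulrCA.
congr (_ * _); rewrite mulrA -exprD subnKC ?minm0 // /W -prodrXr -big_split /=.
by apply: eq_bigr => i _; rewrite horner_exp exprMn exprM.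
Qed.

Lemma msizeM_bound (k : fieldType) n (p q : {mpoly k[n]}) c d :
  (msize p <= c.+1)%N -> (msize q <= d.+1)%N -> (msize (p * q) <= (c + d).+1)%N.
Proof.
have [->|p0] := eqVneq p 0; first by rewrite mul0r msize0.
have [->|q0] := eqVneq q 0; first by rewrite mulr0 msize0.
move=> pc qd; rewrite msizeM // -subn1 leq_subLR add1n -addnS -addSn.
exact: leq_add.
Qed.

Lemma msizeX_bound (k : fieldType) n (p : {mpoly k[n]}) d j :
  (msize p <= d.+1)%N -> (msize (p ^+ j) <= (j * d).+1)%N.
Proof.
move=> pd; elim: j => [|j IHj]; first by rewrite expr0 msize1.
by rewrite exprS mulSn msizeM_bound.
Qed.

Lemma row_kernel_neq0 (k : fieldType) m n (A : 'M[k]_(m, n)) :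
  (n < m)%N -> exists2 u : 'rV_m, u != 0 & u *m A = 0.
Proof.
move=> ltnm; have : kermx A != 0.
  rewrite kermx_eq0 /row_free neq_ltn (leq_ltn_trans (rank_leq_col A)) //.
case/rowV0Pn => u /sub_kermxP uA u0; by exists u.
Qed.

(* Counting: the [d ^ n.+1] monomials of exponents below [d] in the [f i] and
   [b] lie in a space of dimension [(d * c) ^ n], with [c] independent of [d]. *)
Lemma algebraic_dependence (k : fieldType) n (f : 'I_n -> {mpoly k[n]})
    (b : {mpoly k[n]}) :
  exists2 g : {poly {mpoly k[n]}}, g != 0 &
    forall x, root (map_poly (meval (fun i => (f i).@[x])) g) b.@[x].
Proof.
have [D [fD bD]] : exists D, (forall i, msize (f i) <= D.+1)%N /\ (msize b <= D.+1)%N.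
  exists (\max_i msize (f i) + msize b)%N; split=> [i|]; last by rewrite leqW // leq_addl.
  by rewrite leqW // (leq_trans _ (leq_addr _ _)) // (leq_bigmax i).
(* A product of n + 1 powers with exponents below d has degree at most (n + 1)(d - 1)D, less than
   dc; and d > c^n gives d^(n + 1) > (dc)^n. *)
pose c := (n.+1 * D.+1)%N; pose d := (c ^ n).+1.
pose T := ({ffun 'I_n -> 'I_d} * 'I_d)%type.
pose S := {ffun 'I_n -> 'I_(d * c)}.
pose P (t : T) := \prod_i (f i) ^+ t.1 i * b ^+ t.2.
have Pbound t : (msize (P t) <= d * c)%N.
  have tD i : (msize (f i ^+ t.1 i) <= (d.-1 * D).+1)%N.
    by rewrite (leq_trans (msizeX_bound _ (fD i))) // ltnS leq_mul2r -ltnS ltn_ord orbT.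
  have : (msize (P t) <= (n * (d.-1 * D) + d.-1 * D).+1)%N.
    apply: msizeM_bound; last first.
      by rewrite (leq_trans (msizeX_bound _ bD)) // ltnS leq_mul2r -ltnS ltn_ord orbT.
    rewrite -[X in (X * _)%N]card_ord -sum_nat_const.
    apply: (big_ind2 (fun (p : {mpoly k[n]}) e => msize p <= e.+1)%N) => //.
      by rewrite msize1.
    by move=> p e q e'; apply: msizeM_bound.
  move/leq_trans; apply; rewrite -mulSnr /c (mulnCA d) ltn_mul2l /=.
  by rewrite (@leq_ltn_trans (d.-1 * D.+1)) ?leq_mul2l ?leqnSn ?orbT // ltn_mul2r ltnSn.
pose A := \matrix_(i < #|{: T}|, j < #|{: S}|)
  (P (enum_val i))@_[multinom (enum_val j l : nat) | l < n].
have [|u u0 uA] := row_kernel_neq0 A.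
  rewrite card_prod !card_ffun !card_ord expnMn.
  by rewrite ltn_pmul2l ?expn_gt0.
have uP : \sum_i u 0 i *: P (enum_val i) = 0.
  apply/mpolyP => m; rewrite mcoeff0 raddf_sum /=.
  have [mlt|mge] := ltnP (mdeg m) (d * c); last first.
    apply: big1 => i _; rewrite mcoeffZ memN_msupp_eq0 ?mulr0 //.
    by apply: msize_mdeg_ge; apply: leq_trans mge.
  have mi i : (m i < d * c)%N.
    by apply: leq_ltn_trans mlt; rewrite mdegE (bigD1 i) //= leq_addr.
  have /matrixP/(_ 0 (enum_rank [ffun i => Ordinal (mi i)])) := uA.
  rewrite !mxE => uA0; rewrite -[RHS]uA0.
  apply: eq_bigr => i _; rewrite mcoeffZ mxE enum_rankK.
  by congr (_ * _@_ _); apply/mnmP => l; rewrite mnmE ffunE.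
pose M (t : T) := [multinom (t.1 l : nat) | l < n].
(* The linear relation [u], with variables in place of the [f i] and the univariate indeterminate in
   place of [b]. Distinct exponents give distinct monomials, so [g] is nonzero. *)
pose g : {poly {mpoly k[n]}} :=
  \sum_i (u 0 i *: 'X_[M (enum_val i)]) *: 'X^((enum_val i).2 : nat).
exists g.
  have [i ui] : exists i, u 0 i != 0 by apply/rV0Pn.
  apply: contraNneq ui => /(congr1 (fun p : {poly {mpoly k[n]}} =>
     (p`_(enum_val i).2)@_(M (enum_val i)))).
  rewrite coef0 mcoeff0 coef_sum raddf_sum /= (bigD1 i) //= big1 ?addr0; last first.
    move=> j ji; rewrite coefZ coefXn.
    have [e2|_] := eqVneq; last by rewrite mulr0 mcoeff0.
    rewrite mulr1 mcoeffZ mcoeffX; have [/mnmP e1|_] := eqVneq; last by rewrite mulr0.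
    case/eqP: ji; apply: enum_val_inj; case: (enum_val i) e1 e2 => a1 a2.
    case: (enum_val j) => b1 b2 /= e1 e2; congr (_, _); last exact/val_inj.
    by apply/ffunP => l; apply/val_inj; have := e1 l; rewrite !mnmE.
  by rewrite coefZ coefXn eqxx mulr1 mcoeffZ mcoeffX eqxx mulr1 => ->.
move=> x; rewrite /root; apply/eqP.
rewrite rmorph_sum horner_sum -[RHS](meval0 x) -uP raddf_sum /=.
apply: eq_bigr => i _; rewrite -mul_polyC rmorphM /= map_polyXn map_polyC /=.
rewrite hornerM hornerXn hornerC !mevalZ mevalX mevalM -mulrA; congr (_ * _).
rewrite rmorphXn rmorph_prod /=; congr (_ * _); apply: eq_bigr => l _.
by rewrite rmorphXn mnmE.
Qed.

(** * Determinants *)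

(** The case [i = j] is allowed and gives the identity; [det_one_row] relies on it. *)
Lemma perm_two_points (T : finType) (i j : T) (s : {perm T}) :
  (forall a, a != i -> a != j -> s a = a) -> s = 1%g \/ s = tperm i j.
Proof.
move=> sfix.
have sij a : a \in [:: i; j] -> s a \in [:: i; j].
  rewrite !inE; apply: contraTT; rewrite !negb_or => /andP[si sj].
  by rewrite -(perm_inj (sfix _ si sj)) si.
have [sii|sii] := eqVneq (s i) i; [left|right]; apply/permP => a.
  rewrite perm1; have [->//|ai] := eqVneq a i.
  have [->|aj] := eqVneq a j; last exact: sfix.
  have := sij j; rewrite !inE eqxx orbT => /(_ isT)/orP[/eqP e|/eqP//].
  by rewrite e (perm_inj (etrans e (esym sii))).
have si : s i = j.
  by have := sij i; rewrite !inE eqxx (negPf sii) => /(_ isT)/eqP.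
case: tpermP => [->//|->|/eqP ai /eqP aj]; last exact: sfix.
have := sij j; rewrite !inE eqxx orbT => /(_ isT)/orP[/eqP//|/eqP e].
by case/eqP: sii; rewrite si; apply: (@perm_inj _ s); rewrite e si.
Qed.

(** In the Leibniz formula a permutation that moves an index other than [i] and [j] picks a zero
    entry; only the identity and the transposition are left. *)
Lemma det_two_rows (R : comNzRingType) n (M : 'M[R]_n) (i j : 'I_n) :
  i != j -> (forall a b, a != i -> a != j -> a != b -> M a b = 0) ->
  \det M = (M i i * M j j - M i j * M j i) *
    \prod_(a | (a != i) && (a != j)) M a a.
Proof.
move=> ij M0; rewrite /determinant.
rewrite (bigD1 (1%g : 'S_n)) //= (bigD1 (tperm i j)) /=; last first.
  by apply: contra_neq ij => /permP/(_ i); rewrite tpermL perm1.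
rewrite [X in _ + (_ + X)]big1 ?addr0; last first.
  move=> s /andP[s1 sT].
  have [/existsP[a /and3P[ai aj sa]]|] :=
      boolP [exists a, [&& a != i, a != j & a != s a]].
    by rewrite (bigD1 a) //= M0 // mul0r mulr0.
  rewrite negb_exists => /forallP sfix.
  have [a ai aj||] := @perm_two_points _ i j s.
  - by have := sfix a; rewrite ai aj /= negbK => /eqP.
  - by move/eqP: s1.
  - by move/eqP: sT.
rewrite odd_perm1 odd_tperm ij expr0 mul1r expr1 mulN1r mulrBl; congr (_ - _).
  rewrite (bigD1 i) //= (bigD1 j) ?[j == i]eq_sym //= mulrA !perm1.
  by congr (_ * _); apply: eq_bigr => a _; rewrite perm1.
rewrite (bigD1 i) //= (bigD1 j) ?[j == i]eq_sym //= mulrA tpermL tpermR.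
congr (_ * _); apply: eq_bigr => a /andP[ai aj].
by rewrite tpermD // eq_sym.
Qed.

Lemma det_one_row (R : comNzRingType) n (M : 'M[R]_n) (i : 'I_n) :
  (forall a b, a != i -> a != b -> M a b = 0) ->
  \det M = M i i * \prod_(a | a != i) M a a.
Proof.
move=> M0; rewrite /determinant.
rewrite (bigD1 (1%g : 'S_n)) //= [X in _ + X]big1 ?addr0; last first.
  move=> s s1.
  have [/existsP[a /andP[ai sa]]|] := boolP [exists a, (a != i) && (a != s a)].
    by rewrite (bigD1 a) //= M0 // mul0r mulr0.
  rewrite negb_exists => /forallP sfix.
  case/eqP: s1; have [a ai _|//|->] := @perm_two_points _ i i s.
    by have := sfix a; rewrite ai /= negbK => /eqP.
  by rewrite tperm1.
rewrite odd_perm1 expr0 mul1r (bigD1 i) //= perm1; congr (_ * _).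
by apply: eq_bigr => a _; rewrite perm1.
Qed.

(** The matrix diag(l) + X R with X divided out of the rows where [l] vanishes, so that the
    determinant at 0 is the expected leading coefficient of det (diag(l) + t R) for small t. *)
Definition pencil_quotient (k : fieldType) n (l : 'I_n -> k) (R : 'M[k]_n) :
    'M[{poly k}]_n :=
  \matrix_(a, b) if l a == 0 then (R a b)%:P
                 else (l a *+ (a == b))%:P + 'X * (R a b)%:P.

Lemma det_pencil_quotient (k : fieldType) n (l : 'I_n -> k) (R : 'M[k]_n) t :
  \det (\matrix_(a, b) (l a *+ (a == b) + t * R a b)) =
    t ^+ #|[pred a | l a == 0]| * (\det (pencil_quotient l R)).[t].
Proof.
rewrite -horner_evalE -det_map_mx.
pose D := \row_a (if l a == 0 then t else 1).
have -> : t ^+ #|[pred a | l a == 0]| = \det (diag_mx D).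
  rewrite det_diag -prodr_const big_mkcond /=; apply: eq_bigr => a _.
  by rewrite mxE inE.
rewrite -det_mulmx; congr (\det _); apply/matrixP => a b.
rewrite mul_diag_mx !mxE /= /horner_eval.
case: (l a =P 0) => [->|_]; first by rewrite mul0rn add0r hornerC.
by rewrite mul1r hornerD hornerM hornerX !hornerC.
Qed.

Lemma pencil_quotient0 (k : fieldType) n (l : 'I_n -> k) (R : 'M[k]_n) :
  (\det (pencil_quotient l R)).[0] =
    \det (\matrix_(a, b) if l a == 0 then R a b else l a *+ (a == b)).
Proof.
rewrite -horner_evalE -det_map_mx; congr (\det _); apply/matrixP => a b.
rewrite !mxE /= /horner_eval; case: (l a =P 0) => _; rewrite ?hornerC //.
by rewrite hornerD hornerM hornerX !hornerC mul0r addr0.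
Qed.

(** * Independence of the equations *)

(* A slot names an unknown and, at the same time, the equation that serves to
   eliminate it: [None] is the scaling factor minus 1, [inl a] the a-th diagonal
   entry of B_1 and [inr (a, b)] with [a <= b] the entry of B_i. A lower slot
   [inr (a, b)] with [b < a] is a dummy, whose equation is the unknown itself. *)
Definition slot (n : nat) : finType := option ('I_n + 'I_n * 'I_n)%type.

Definition lower_slot n (w : slot n) : bool :=
  if w is Some (inr (i, j)) then (j < i)%N else false.

Definition slot_diag (R : Type) n (v : slot n -> R) (a : 'I_n) : R :=
  v (Some (inl a)).

Definition slot_symm (R : Type) n (v : slot n -> R) (a b : 'I_n) : R :=
  v (Some (inr (if (a <= b)%N then (a, b) else (b, a)))).

Definition slot_pencil (R : comNzRingType) n (x y z : R) (v : slot n -> R) :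
    'M[R]_n :=
  \matrix_(a, b) ((x + y * slot_diag v a) *+ (a == b) + z * slot_symm v a b).

(* The line [x + l_a y + l_a ^ 2 z = 0] contains the point of [inl i] iff
   [a = i], and the point of [inr (i, j)] iff [a] is [i] or [j]. *)
Definition slot_point (k : comNzRingType) n (l : 'I_n -> k) (w : slot n) :
    k * k * k :=
  match w with
  | None => (1, 0, 0)
  | Some (inl i) => (- l i, 1, 0)
  | Some (inr (i, j)) => (l i * l j, - (l i + l j), 1)
  end.

(** [iota] carries the coordinates of the points into [R]: [id] gives values and [mpolyC] gives
    polynomials. The equation of [None] is the value at (1, 0, 0) minus 1, so that it vanishes at
    [slot_base] like all the others. *)
Definition slot_value (k R : comNzRingType) (iota : k -> R) n (l : 'I_n -> k)
    (v : slot n -> R) (w : slot n) : R :=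
  if lower_slot w || (w == None) then v w else
  let: (x, y, z) := slot_point l w in
  (1 + v None) * \det (slot_pencil (iota x) (iota y) (iota z) v).

(** The pencil of tangents: scaling factor 1, B_1 = diag(l_a) and B_i = diag(l_a ^ 2). *)
Definition slot_base (k : comNzRingType) n (l : 'I_n -> k) (w : slot n) : k :=
  match w with
  | None => 0
  | Some (inl i) => l i
  | Some (inr (i, j)) => l i ^+ 2 *+ (i == j)
  end.

(** For a determinantal equation, the number of tangents through its point; the remaining equations
    are linear. *)
Definition slot_weight n (w : slot n) : nat :=
  if w is Some (inr (i, j)) then (i < j)%N.+1 else 1%N.

Lemma slot_symmC (R : Type) n (v : slot n -> R) a b :
  slot_symm v a b = slot_symm v b a.
Proof.
rewrite /slot_symm; case: (ltngtP a b) => // /val_inj -> //.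
Qed.

(** At the point of [w] the pencil is diag(q w) + t R. The leading coefficient is a product of
    nonzero values of [q w] times an entry R_ii, or times a 2 x 2 minor when two tangents meet. The
    system is triangular: first the diagonal of B_1, then that of B_i, then the squares of the
    off-diagonal entries. *)
Lemma slot_value_dominant (k : closedFieldType) n (l : 'I_n -> k) :
  injective l -> forall u : slot n -> k,
  exists v : slot n -> k, exists h : slot n -> {poly k},
    (forall w, (h w).[0] = u w) /\
    (forall w t, slot_value id l (fun w => slot_base l w + t * v w) w =
       t ^+ slot_weight w * (h w).[t]).
Proof.
move=> linj u.
pose q (w : slot n) a : k :=
  let: (x, y, z) := slot_point l w in x + y * l a + z * l a ^+ 2.
have q1 i a : q (Some (inl i)) a = l a - l i by rewrite /q /=; ring.
have q2 i j a : q (Some (inr (i, j))) a = (l a - l i) * (l a - l j).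
  by rewrite /q /=; ring.
pose P1 (i : 'I_n) := \prod_(a | a != i) (l a - l i).
pose P2 (i j : 'I_n) := \prod_(a | (a != i) && (a != j)) ((l a - l i) * (l a - l j)).
have P1_0 i : P1 i != 0.
  by apply/prodf_neq0 => a ai; rewrite subr_eq0 (inj_eq linj).
have P2_0 i j : P2 i j != 0.
  by apply/prodf_neq0 => a /andP[ai aj]; rewrite mulf_neq0 ?subr_eq0 ?(inj_eq linj).
pose e i := u (Some (inl i)) / P1 i.
pose P3 (i : 'I_n) := \prod_(a | a != i) ((l a - l i) * (l a - l i)).
have P3_0 i : P3 i != 0.
  by apply/prodf_neq0 => a ai; rewrite mulf_neq0 ?subr_eq0 ?(inj_eq linj).
(* At the point of [inr (i, i)] the entry R_ii is m i - 2 l_i e i. *)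
pose m i := u (Some (inr (i, i))) / P3 i + (l i + l i) * e i.
(* The entry R_aa at the point of [inr (i, j)]; the minor to be matched below is d_i d_j - s^2. *)
pose d i j a := m a - (l i + l j) * e a.
have [s sE] : exists s : 'I_n * 'I_n -> k, forall ij,
    s ij ^+ 2 = d ij.1 ij.2 ij.1 * d ij.1 ij.2 ij.2 - u (Some (inr ij)) / P2 ij.1 ij.2.
  apply: (@fin_all_exists _ (fun=> k) (fun ij x => x ^+ 2 =
     d ij.1 ij.2 ij.1 * d ij.1 ij.2 ij.2 - u (Some (inr ij)) / P2 ij.1 ij.2)) => ij.
  set c := _ - _.
  have /closed_rootP[x] : size ('X^2 - c%:P) != 1%N by rewrite size_XnsubC.
  by rewrite /root hornerD hornerN hornerXn hornerC subr_eq0 => /eqP; exists x.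
pose v (w : slot n) : k :=
  match w with
  | None => u None
  | Some (inl i) => e i
  | Some (inr (i, j)) => if (i < j)%N then s (i, j) else if i == j then m i
                         else u (Some (inr (i, j)))
  end.
pose R (w : slot n) : 'M[k]_n :=
  let: (x, y, z) := slot_point l w in
  \matrix_(a, b) (y * slot_diag v a *+ (a == b) + z * slot_symm v a b).
exists v; exists (fun w => if lower_slot w || (w == None) then (v w)%:P
  else (1 + 'X * (v None)%:P) * \det (pencil_quotient (q w) (R w))).
have vmm i : slot_symm v i i = m i by rewrite /slot_symm leqnn /= ltnn eqxx.
split=> w.
  case: ifP => [|wact].
    rewrite hornerC; case: w => [[|[i j]]|] //=; rewrite orbF => ji.
    by rewrite ltnNge ltnW //= -val_eqE gtn_eqF.
  rewrite hornerM hornerD hornerM hornerX !hornerC mul0r addr0 mul1r pencil_quotient0.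
  case: w wact => [[i|[i j]]|] //= wact.
    rewrite (@det_one_row _ _ _ i); last first.
      move=> a b ai /negPf ab; rewrite mxE q1 subr_eq0 (inj_eq linj) (negPf ai).
      by rewrite ab.
    rewrite !mxE q1 subrr !eqxx mul1r mul0r addr0 /slot_diag /=.
    rewrite (eq_bigr (fun a => l a - l i)) ?divfK // => a ai.
    by rewrite mxE q1 subr_eq0 (inj_eq linj) (negPf ai) eqxx.
  have qq a : (q (Some (inr (i, j))) a == 0) = (a == i) || (a == j).
    by rewrite q2 mulf_eq0 !subr_eq0 !(inj_eq linj).
  have [eij|ij] := eqVneq i j.
    subst j; rewrite (@det_one_row _ _ _ i); last first.
      move=> a b ai /negPf ab; rewrite mxE qq (negPf ai).
      by rewrite ab.
    rewrite !mxE qq !eqxx /= mul1r vmm /slot_diag /=.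
    rewrite (eq_bigr (fun a => (l a - l i) * (l a - l i))); last first.
      by move=> a ai; rewrite mxE qq (negPf ai) eqxx q2.
    by rewrite -/(P3 i) /m mulNr addrC addrK divfK.
  have ltij : (i < j)%N.
    move: wact; rewrite orbF => /negbT; rewrite -leqNgt leq_eqVlt.
    by rewrite (negPf ij : (i == j :> nat) = false).
  rewrite (@det_two_rows _ _ _ i j) //; last first.
    by move=> a b ai aj /negPf ab; rewrite mxE qq (negPf ai) (negPf aj) ab.
  rewrite (eq_bigr (fun a => (l a - l i) * (l a - l j))); last first.
    by move=> a /andP[ai aj]; rewrite mxE qq (negPf ai) (negPf aj) eqxx q2.
  rewrite -/(P2 i j) !mxE !qq !eqxx orbT /= !mul1r !vmm /slot_diag /=.
  rewrite [slot_symm v j i]slot_symmC (negPf ij) [j == i]eq_sym (negPf ij) !mulr0n !add0r.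
  have -> : slot_symm v i j = s (i, j) by rewrite /slot_symm ltnW //= ltij.
  rewrite -expr2 sE /= /d.
  set c := u _ / _; rewrite [X in X * _](_ : _ = c); last by ring.
  by rewrite divfK.
move=> t; rewrite /slot_value; case: ifP => [|wact].
  rewrite hornerC; case: w => [[|[i j]]|] //=; rewrite ?orbF => ji; last first.
    by rewrite add0r expr1.
  rewrite [i == j]eq_sym -val_eqE ltn_eqF // mulr0n add0r.
  by rewrite ltnNge ltnW.
rewrite hornerM hornerD hornerM hornerX !hornerC mulrCA /slot_base add0r.
case wE : (slot_point l w) => [[x y] z]; congr (_ * _).
have -> : slot_weight w = #|[pred a | q w a == 0]|.
  case: w wact {wE} => [[i|[i j]]|] //= wact.
    rewrite -(card1 i); apply: eq_card => a.
    by rewrite !inE q1 subr_eq0 (inj_eq linj).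
  have ->: (i < j)%N = (i != j).
    by move: wact; rewrite orbF neq_ltn => ->; rewrite orbF.
  rewrite -card2; apply: eq_card => a.
  by rewrite !inE q2 mulf_eq0 !subr_eq0 !(inj_eq linj).
rewrite -det_pencil_quotient; congr (\det _); apply/matrixP => a b.
rewrite !mxE /q /R wE mxE /slot_diag /slot_symm.
have [<-|ab] := eqVneq a b; first by rewrite leqnn eqxx !mulr1n; ring.
rewrite !mulr0n !add0r; set ab' := (if _ then _ else _).
have : ab'.1 != ab'.2 by rewrite /ab'; case: ifP => _ //=; rewrite eq_sym.
by case: ab' => c c' /= /negPf->; rewrite mulr0n add0r; ring.
Qed.

(** * Normal form of a symmetric pencil *)

Lemma closed_field_injection (k : closedFieldType) n :
  exists l : 'I_n -> k, injective l.
Proof.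
have [s us sz] : exists2 s : seq k, uniq s & size s = n.
  elim: n => [|n [s us <-]]; first by exists [::].
  have /closed_nonrootP[x] : \prod_(z <- s) ('X - z%:P) != 0.
    by apply: monic_neq0; apply: monic_prod_XsubC.
  by rewrite root_prod_XsubC => xs; exists (x :: s); rewrite //= xs.
exists (fun i : 'I_n => s`_i) => i j /eqP.
by rewrite nth_uniq ?sz // => /eqP/val_inj.
Qed.

Lemma horner_char_poly (R : comNzRingType) n (A : 'M[R]_n) t :
  (char_poly A).[t] = \det (t%:M - A).
Proof.
rewrite -horner_evalE -det_map_mx; congr (\det _); apply/matrixP => i j.
by rewrite !mxE /= /horner_eval hornerD hornerN hornerMn hornerX hornerC.
Qed.

Lemma root_char_poly_eigenvector (k : fieldType) n (A : 'M[k]_n) a :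
  root (char_poly A) a -> exists2 v : 'rV_n, v != 0 & v *m A = a *: v.
Proof.
rewrite -eigenvalue_root_char => /eigenvalueP[v vA v0]; by exists v.
Qed.

(** The product of the values of the derivative of the characteristic polynomial at the eigenvalues:
    up to sign, its discriminant. This form is visibly polynomial in the entries. *)
Definition char_discr (R : comNzRingType) n (A : 'M[R]_n.+1) : R :=
  \det (horner_mx A (char_poly A)^`()).

Lemma map_char_discr (R S : comNzRingType) (f : {rmorphism R -> S}) n
    (A : 'M[R]_n.+1) :
  char_discr (map_mx f A) = f (char_discr A).
Proof. by rewrite /char_discr -map_char_poly deriv_map -map_horner_mx det_map_mx. Qed.

Lemma horner_mx_eigenvector (k : fieldType) n (A : 'M[k]_n.+1) (v : 'rV_n.+1) a p :
  v *m A = a *: v -> v *m horner_mx A p = p.[a] *: v.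
Proof.
move=> vA; elim/poly_ind: p => [|p c IHp].
  by rewrite rmorph0 horner0 mulmx0 scale0r.
rewrite rmorphD rmorphM /= horner_mx_X horner_mx_C mulmxDr mulmxA IHp.
by rewrite -scalemxAl vA scalerA hornerMXaddC scalerDl mul_mx_scalar.
Qed.

Lemma char_discr_root (k : fieldType) n (A : 'M[k]_n.+1) a :
  char_discr A != 0 -> root (char_poly A) a -> (char_poly A)^`().[a] != 0.
Proof.
move=> dA /root_char_poly_eigenvector[v v0 vA]; apply: contraNneq v0 => pa.
have := horner_mx_eigenvector (char_poly A)^`() vA; rewrite pa scale0r => vp.
rewrite -(mulmxK (_ : horner_mx A (char_poly A)^`() \in unitmx) v) ?vp ?mul0mx //.
by rewrite unitmxE unitfE.
Qed.

Lemma char_poly_scale (k : closedFieldType) n (A : 'M[k]_n) a :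
  char_poly (a *: A) \Po (a *: 'X) = a ^+ n *: char_poly A.
Proof.
apply/eqP; rewrite -subr_eq0; apply/eqP/poly_eq0_horner => t.
rewrite hornerD hornerN horner_comp !hornerZ hornerX !horner_char_poly -detZ.
by rewrite -scale_scalar_mx -scalerBr subrr.
Qed.

(** The scaling serves to replace A_1 A_0^-1 by its multiple A_1 adj(A_0), which is polynomial in
    the entries. *)
Lemma char_discr_scale_separable (k : closedFieldType) n (A : 'M[k]_n.+1) a :
  a != 0 -> char_discr (a *: A) != 0 -> separable_poly (char_poly A).
Proof.
move=> a0 dA; rewrite separable_poly.unlock; apply/Pdiv.ClosedField.coprimepP => x.
have an0 : a ^+ n.+1 != 0 by rewrite expf_neq0.
have E := char_poly_scale A a.
have ->: root (char_poly A) x = root (char_poly (a *: A)) (a * x).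
  by rewrite -(rootZ _ _ an0) -E /root horner_comp hornerZ hornerX.
move/(char_discr_root dA); apply: contra_neq => px.
have : (char_poly (a *: A) \Po (a *: 'X))^`().[x] = 0.
  by rewrite E derivZ hornerZ px mulr0.
rewrite deriv_comp derivZ derivX hornerM hornerZ hornerC mulr1.
rewrite horner_comp hornerZ hornerX.
by move/eqP; rewrite mulf_eq0 (negPf a0) orbF => /eqP.
Qed.

Lemma char_discr_diag (k : fieldType) n (d : 'rV[k]_n.+1) :
  injective (d 0) -> char_discr (diag_mx d) != 0.
Proof.
move=> dinj; rewrite /char_discr horner_mx_diag det_diag; apply/prodf_neq0 => i _.
have sep : separable_poly (char_poly (diag_mx d)).
  rewrite char_poly_trig ?diag_mx_is_trig //.
  rewrite (eq_bigr (fun i => 'X - (d 0 i)%:P)); last by move=> j _; rewrite mxE eqxx.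
  rewrite -(big_map (d 0) xpredT (fun x => 'X - x%:P)) separable_prod_XsubC.
  by rewrite map_inj_uniq ?index_enum_uniq.
rewrite mxE; move: sep; rewrite separable_poly.unlock => /coprimep_root; apply.
rewrite char_poly_trig ?diag_mx_is_trig // (bigD1 i) //=.
by rewrite rootM mxE eqxx root_XsubC eqxx.
Qed.

(** Let P diagonalise B_1 B_0^-1 to D and put E = P B_0 P^T. Both E and D E = P B_1 P^T are
    symmetric, so D commutes with E; the entries of D being distinct, E is diagonal, and square
    roots rescale it to 1. *)
Lemma symmetric_pencil_normal_form (k : closedFieldType) n (B0 B1 : 'M[k]_n.+1) :
  B0^T = B0 -> B1^T = B1 -> B0 \in unitmx ->
  separable_poly (char_poly (B1 *m invmx B0)) ->
  exists P, exists d, [/\ P \in unitmx, P *m B0 *m P^T = 1%:M &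
                         P *m B1 *m P^T = diag_mx d].
Proof.
move=> sB0 sB1 uB0; set X := B1 *m invmx B0 => sepX.
have [rs rsE] := closed_field_poly_normal (char_poly X).
rewrite (monicP (char_poly_monic X)) scale1r in rsE.
have /diagonalizableP[P uP /diagonalizable_forPex[D /(simmxP uP) PX]] :
    exists2 rs, uniq rs & mxminpoly X %| \prod_(x <- rs) ('X - x%:P).
  exists rs; first by rewrite -separable_prod_XsubC -rsE.
  by rewrite -rsE mxminpoly_dvd_char.
have Dinj : injective (D 0).
  have cpE : char_poly X = char_poly (diag_mx D).
    have -> : diag_mx D = P *m X *m invmx P by rewrite PX mulmxK.
    apply/eqP; rewrite -subr_eq0; apply/eqP/poly_eq0_horner => t.
    rewrite hornerD hornerN !horner_char_poly.
    have -> : t%:M - P *m X *m invmx P = P *m (t%:M - X) *m invmx P.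
      by rewrite mulmxBr mulmxBl scalar_mxC mulmxK.
    by rewrite !det_mulmx mulrAC -det_mulmx mulmxV // det1 mul1r subrr.
  move: sepX; rewrite cpE char_poly_trig ?diag_mx_is_trig //.
  rewrite (eq_bigr (fun i => 'X - (D 0 i)%:P)); last by move=> j _; rewrite mxE eqxx.
  rewrite -(big_map (D 0) xpredT (fun x => 'X - x%:P)) separable_prod_XsubC.
  rewrite [index_enum _]unlock -enumT => uD.
  exact/injectiveP.
have [E EE] : exists E, E = P *m B0 *m P^T by eexists.
have PB1 : P *m B1 *m P^T = diag_mx D *m E.
  by rewrite EE !mulmxA -PX /X mulmxA mulmxKV.
have sE : E^T = E by rewrite EE !trmx_mul trmxK sB0 mulmxA.
have DE : diag_mx D *m E = E *m diag_mx D.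
  by rewrite -[RHS]trmxK trmx_mul tr_diag_mx sE -PB1 !trmx_mul trmxK sB1 mulmxA.
have E0 i j : i != j -> E i j = 0.
  move=> ij; have /matrixP/(_ i j) := DE; rewrite mul_diag_mx mul_mx_diag !mxE mulrC.
  move/eqP; rewrite -subr_eq0 -mulrBr mulf_eq0 subr_eq0 (inj_eq Dinj) (negPf ij) orbF.
  by move/eqP.
have ED : E = diag_mx (\row_i E i i).
  apply/matrixP => i j; rewrite !mxE; case: eqVneq => [->|ij]; first by rewrite mulr1n.
  by rewrite mulr0n E0.
have E1 i : E i i != 0.
  have : \det (diag_mx (\row_i E i i)) != 0.
    by rewrite -ED -unitfE -unitmxE EE !unitmx_mul unitmx_tr uP uB0.
  by rewrite det_diag => /prodf_neq0/(_ i isT); rewrite mxE.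
have [s sE2] : exists s : 'I_n.+1 -> k, forall i, s i ^+ 2 = E i i.
  apply: (@fin_all_exists _ (fun=> k) (fun i x => x ^+ 2 = E i i)) => i.
  have /closed_rootP[x] : size ('X^2 - (E i i)%:P) != 1%N by rewrite size_XnsubC.
  by rewrite /root hornerD hornerN hornerXn hornerC subr_eq0 => /eqP; exists x.
have s0 i : s i != 0 by have := E1 i; rewrite -sE2 expf_eq0.
pose S := diag_mx (\row_i (s i)^-1).
have SES : S *m E *m S = 1%:M.
  apply/matrixP => i j; rewrite mul_diag_mx mul_mx_diag !mxE mulrAC.
  case: eqVneq => [->|ij]; last by rewrite E0 // mulr0.
  by rewrite -sE2 expr2 mulrACA mulVf // mulr1.
have trS : (S *m P)^T = P^T *m S by rewrite trmx_mul tr_diag_mx.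
exists (S *m P); exists D; rewrite trS; split.
- rewrite unitmx_mul uP andbT unitmxE unitfE det_diag; apply/prodf_neq0 => i _.
  by rewrite mxE invr_neq0.
- by rewrite -SES EE !mulmxA.
have -> : S *m P *m B1 *m (P^T *m S) = S *m (P *m B1 *m P^T) *m S by rewrite !mulmxA.
by rewrite PB1 mulmxA [S *m _]diag_mxC -!mulmxA [X in _ *m X]mulmxA SES mulmx1.
Qed.

(** * Finiteness *)

Lemma eq_slot_value (k R : comNzRingType) (iota : k -> R) n (l : 'I_n -> k)
    (v v' : slot n -> R) w :
  v =1 v' -> slot_value iota l v w = slot_value iota l v' w.
Proof.
move=> vv; rewrite /slot_value !vv; case: ifP => // _.
case: slot_point => [[x y] z]; congr (_ * \det _); apply/matrixP => a b.
by rewrite !mxE /slot_diag /slot_symm !vv.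
Qed.

Lemma rmorph_slot_value (k R S : comNzRingType) (f : {rmorphism R -> S})
    (iota : k -> R) n (l : 'I_n -> k) (v : slot n -> R) w :
  f (slot_value iota l v w) = slot_value (f \o iota) l (f \o v) w.
Proof.
rewrite /slot_value; case: ifP => // _; case: slot_point => [[x y] z].
rewrite rmorphM rmorphD rmorph1 -det_map_mx; congr (_ * \det _).
by apply/matrixP => a b; rewrite !mxE rmorphD rmorphMn rmorphD !rmorphM.
Qed.

Definition slot_values (k : comNzRingType) n (l : 'I_n -> k) (v : slot n -> k)
    (j : 'I_#|slot n|) : k :=
  slot_value id l v (enum_val j).

Definition slot_poly (k : comNzRingType) n (l : 'I_n -> k) (j : 'I_#|slot n|) :
    {mpoly k[#|slot n|]} :=
  slot_value (@mpolyC _ k) l (fun w => 'X_(enum_rank w)) (enum_val j).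

Lemma meval_slot_poly (k : comNzRingType) n (l : 'I_n -> k) v j :
  (slot_poly l j).@[fun i => v (enum_val i)] = slot_values l v j.
Proof.
rewrite /slot_poly rmorph_slot_value /slot_values.
have -> : slot_value id l v (enum_val j) =
    slot_value id l (meval (fun i => v (enum_val i)) \o (fun w => 'X_(enum_rank w)))
      (enum_val j).
  by apply: eq_slot_value => w /=; rewrite mevalXU enum_rankK.
rewrite /slot_value; case: ifP => // _; case: slot_point => [[x y] z] /=.
by rewrite !mevalC.
Qed.

(** There are as many equations as unknowns, so each unknown together with the equations is one
    polynomial too many. *)
Lemma slot_relation (k : fieldType) n (l : 'I_n -> k) (w : slot n) :
  exists2 g : {poly {mpoly k[#|slot n|]}}, g != 0 &
    forall v, root (map_poly (meval (slot_values l v)) g) (v w).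
Proof.
have [g g0 gr] := algebraic_dependence (slot_poly l) 'X_(enum_rank w).
exists g => // v; have := gr (fun i => v (enum_val i)).
rewrite mevalXU enum_rankK => {}gr.
rewrite (_ : map_poly _ g = map_poly (meval (fun i =>
  (slot_poly l i).@[fun i => v (enum_val i)])) g) //.
apply/polyP => i; rewrite !coef_map /=; apply: meval_eq => j.
by rewrite meval_slot_poly.
Qed.

(** Independence of the equations: a curve from [slot_value_dominant], taken for the [u] of
    [meval_lowest_weight], leaves the zeros of [p], so [p] composed with the equations is a nonzero
    polynomial. The factor [q] adds an open condition on the unknowns themselves. *)
Lemma slot_values_dense (k : closedFieldType) n (l : 'I_n -> k)
    (p q : {mpoly k[#|slot n|]}) :
  injective l -> p != 0 -> q != 0 ->
  exists v, p.@[slot_values l v] != 0 /\ q.@[fun j => v (enum_val j)] != 0.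
Proof.
move=> linj p0 q0.
pose lq := [tuple slot_poly l j | j < #|slot n|].
have lqE v : (p \mPo lq).@[fun j => v (enum_val j)] = p.@[slot_values l v].
  rewrite comp_mpoly_meval; apply: meval_eq => j.
  by rewrite tnth_mktuple meval_slot_poly.
have pl0 : p \mPo lq != 0.
  have [u uP] := meval_lowest_weight (fun j => slot_weight (enum_val j)) p0.
  have [v [h [h0 hE]]] := slot_value_dominant linj (fun w => u (enum_rank w)).
  have [j|t] := uP (fun j => h (enum_val j)); first by rewrite h0 enum_valK.
  apply: contraNneq => pl; apply/eqP.
  have := lqE (fun w => slot_base l w + t * v w); rewrite pl meval0 => ->.
  by apply: meval_eq => j; rewrite -hE.
have /meval_neq0[x] : (p \mPo lq) * q != 0 by rewrite mulf_neq0.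
rewrite mevalM mulf_eq0 negb_or => /andP[px qx].
exists (fun w => x (enum_rank w)); split.
  rewrite -lqE; apply: contraNneq px => <-; apply/eqP/meval_eq => j.
  by rewrite enum_valK.
by apply: contraNneq qx => <-; apply/eqP/meval_eq => j; rewrite enum_valK.
Qed.

(** * Determinantal forms and equivalence of tuples *)

Lemma meval_det_form (k : fieldType) n r (A : mxtuple k n r) x :
  (det_form A).@[x] = \det (\sum_i x i *: A i).
Proof.
rewrite /det_form -det_map_mx raddf_sum; congr (\det _); apply: eq_bigr => i _.
by apply/matrixP => a b; rewrite !mxE /= mevalM mevalXU mevalC.
Qed.

Lemma det_form_congr (k : fieldType) n r (A B : mxtuple k n r) (g : 'M[k]_n) :
  (forall i, B i = g^T *m A i *m g) ->
  det_form B = (\det g ^+ 2) *: det_form A.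
Proof.
move=> BE; rewrite /det_form.
have -> : \sum_(i < r.+1) 'X_i *: map_mx (@mpolyC r.+1 k) (B i) =
    map_mx (@mpolyC r.+1 k) g^T *m
    (\sum_(i < r.+1) 'X_i *: map_mx (@mpolyC r.+1 k) (A i)) *m map_mx (@mpolyC r.+1 k) g.
  rewrite mulmx_sumr mulmx_suml; apply: eq_bigr => i _.
  by rewrite BE !map_mxM -scalemxAr -scalemxAl.
rewrite !det_mulmx !det_map_mx det_tr mulrC mulrA -expr2 -rmorphXn /=.
by rewrite mul_mpolyC.
Qed.

Lemma symm_presentation_equiv (k : fieldType) n r (A B C : mxtuple k n r) :
  tuple_equiv C B -> symm_presentation A C -> symm_presentation A B.
Proof.
case=> g ug BE [sC [c c0 CE]]; split=> [i|].
  by rewrite BE !trmx_mul trmxK sC mulmxA.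
exists (\det g ^+ 2 * c); last by rewrite (det_form_congr BE) CE scalerA.
by rewrite mulf_neq0 // expf_neq0 // -unitfE -unitmxE.
Qed.

Lemma tuple_equiv_sym (k : fieldType) n r (A B : mxtuple k n r) :
  tuple_equiv A B -> tuple_equiv B A.
Proof.
case=> g ug BE; exists (invmx g); first by rewrite unitmx_inv.
move=> i; rewrite BE !mulmxA mulmxK // -trmx_mul mulmxV //.
by rewrite trmx1 mul1mx.
Qed.

Lemma sum_three_terms (k : fieldType) n r (A : mxtuple k n r) (i1 i2 : 'I_r.+1)
    (x y z : k) :
  i1 != ord0 -> i2 != ord0 -> i2 != i1 ->
  \sum_i (if i == ord0 then x else if i == i1 then y
          else if i == i2 then z else 0) *: A i =
    x *: A ord0 + y *: A i1 + z *: A i2.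
Proof.
move=> i10 i20 i21; rewrite (bigD1 ord0) //= (bigD1 i1) //= (bigD1 i2) ?i20 //=.
rewrite !eqxx (negPf i10) (negPf i20) (negPf i21) big1 ?addr0 ?addrA // => i.
by case/andP => /andP[/negPf-> /negPf->] /negPf->; rewrite scale0r.
Qed.

(** * The equations as functions of the given tuple *)

Definition generic_mx (k : fieldType) n r (i : 'I_r.+1) :
    'M[{mpoly k[#|coord_index n r|]}]_n :=
  \matrix_(a, b) 'X_(enum_rank ((i, a, b) : coord_index n r)).

Lemma map_generic_mx (k : fieldType) n r (A : mxtuple k n r) i :
  map_mx (meval (coords A)) (generic_mx k n i) = A i.
Proof.
apply/matrixP => a b; rewrite !mxE /= mevalXU /coords enum_rankK //.
Qed.

(* The values of the equations on a presentation in normal form, computed from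
   any other presentation of the same form; [c] is the value of the dummies. *)
Definition pencil_value (k R : comNzRingType) (iota : k -> R) n (l : 'I_n -> k)
    (c : slot n -> k) (M0 M1 M2 : 'M[R]_n) (w : slot n) : R :=
  if lower_slot w then iota (c w) else if w == None then \det M0 - 1 else
  let: (x, y, z) := slot_point l w in
  \det (iota x *: M0 + iota y *: M1 + iota z *: M2).

Lemma rmorph_pencil_value (k R S : comNzRingType) (f : {rmorphism R -> S})
    (iota : k -> R) n (l : 'I_n -> k) (c : slot n -> k)
    (M0 M1 M2 : 'M[R]_n) w :
  f (pencil_value iota l c M0 M1 M2 w) =
  pencil_value (f \o iota) l c (map_mx f M0) (map_mx f M1) (map_mx f M2) w.
Proof.
rewrite /pencil_value; case: ifP => _ //.
case: ifP => _; first by rewrite rmorphB rmorph1 -det_map_mx.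
by case: slot_point => [[x y] z]; rewrite -det_map_mx !map_mxD !map_mxZ.
Qed.

Definition normal_slot (k : nzRingType) n (c : slot n -> k) (e : k) (d : 'rV[k]_n)
    (C : 'M[k]_n) (w : slot n) : k :=
  match w with
  | None => e - 1
  | Some (inl a) => d 0 a
  | Some (inr (a, b)) => if (b < a)%N then c w else C a b
  end.

Lemma pencil_value_normal (k : fieldType) n (l : 'I_n -> k)
    (c : slot n -> k) (A0 A1 A2 C : 'M[k]_n) (d : 'rV[k]_n) w :
  C^T = C ->
  (forall x y z, \det (x *: A0 + y *: A1 + z *: A2) =
     \det A0 * \det (x%:M + y *: diag_mx d + z *: C)) ->
  slot_value id l (normal_slot c (\det A0) d C) w = pencil_value id l c A0 A1 A2 w.
Proof.
move=> sC detE; rewrite /slot_value /pencil_value.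
have [low|_] /= := boolP (lower_slot w).
  by case: w low => [[|[i j]]|] //= ->.
case: eqP => [->//|_]; case: slot_point => [[x y] z].
rewrite addrC subrK detE; congr (_ * \det _); apply/matrixP => a b.
rewrite !mxE /slot_diag /slot_symm /= mulrnDl mulrnAr; congr (_ + _ * _).
case: (leqP a b) => ab /=; first by rewrite ltnNge ab.
by rewrite ltnNge ltnW //= -[in RHS]sC mxE.
Qed.

Definition poly_roots (k : closedFieldType) (p : {poly k}) : seq k :=
  sval (closed_field_poly_normal p).

Lemma mem_poly_roots (k : closedFieldType) (p : {poly k}) x :
  p != 0 -> root p x -> x \in poly_roots p.
Proof.
rewrite /poly_roots; case: closed_field_poly_normal => rs /= E p0.
by rewrite {1}E rootZ ?lead_coef_eq0 // root_prod_XsubC.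
Qed.

Lemma lead_coef_map_neq0 (R S : nzRingType) (f : {rmorphism R -> S}) (p : {poly R}) :
  f (lead_coef p) != 0 -> map_poly f p != 0.
Proof.
apply: contraNneq => /(congr1 (fun q : {poly S} => q`_(size p).-1)).
by rewrite coef_map coef0 => ->.
Qed.

Lemma scale_mul_invmx (R : comUnitRingType) n (M N : 'M[R]_n) :
  M \in unitmx -> \det M *: (N *m invmx M) = N *m \adj M.
Proof.
move=> uM; rewrite /invmx uM -scalemxAr scalerA divrr ?scale1r //.
Qed.

Lemma char_poly_pencil (k : fieldType) n (B0 B1 : 'M[k]_n) t :
  B0 \in unitmx ->
  (char_poly (B1 *m invmx B0)).[t] * \det B0 = \det (t *: B0 - B1).
Proof.
move=> uB0; rewrite horner_char_poly -det_mulmx mulmxBl mul_scalar_mx.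
by rewrite mulmxKV.
Qed.

Section Finiteness.

Variables (k : closedFieldType) (m r : nat).
Let n := m.+1.
Variables (l : 'I_n -> k) (g : slot n -> {poly {mpoly k[#|slot n|]}}).
Hypothesis gP : forall w v, root (map_poly (meval (slot_values l v)) (g w)) (v w).
Variable c : slot n -> k.
Let i1 : 'I_r.+1 := inord 1.

Let values (A : mxtuple k n r) (i : 'I_r.+1) (j : 'I_#|slot n|) : k :=
  pencil_value id l c (A ord0) (A i1) (A i) (enum_val j).

Let generic_values (i : 'I_r.+1) :=
  [tuple pencil_value (@mpolyC #|coord_index n r| k) l c (generic_mx k n ord0)
     (generic_mx k n i1) (generic_mx k n i) (enum_val j) | j < #|slot n|].

(** The factors make A_0 invertible, make the eigenvalues of A_1 A_0^-1 distinct, and keep every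
    relation [g w] nonzero when its coefficients are evaluated at the values of A. *)
Definition good_poly : {mpoly k[#|coord_index n r|]} :=
  \det (generic_mx k n (ord0 : 'I_r.+1)) *
  char_discr (generic_mx k n i1 *m \adj (generic_mx k n ord0)) *
  \prod_(i < r.+1 | (1 < i)%N) \prod_w (lead_coef (g w) \mPo generic_values i).

Lemma meval_good_poly (A : mxtuple k n r) :
  good_poly.@[coords A] =
    \det (A ord0) * char_discr (A i1 *m \adj (A ord0)) *
    \prod_(i < r.+1 | (1 < i)%N) \prod_w (lead_coef (g w)).@[values A i].
Proof.
rewrite !mevalM -det_map_mx -map_char_discr map_mxM map_mx_adj !map_generic_mx.
congr (_ * _); rewrite rmorph_prod; apply: eq_bigr => i _.
rewrite rmorph_prod; apply: eq_bigr => w _ /=.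
rewrite comp_mpoly_meval; apply: meval_eq => j.
rewrite tnth_mktuple rmorph_pencil_value !map_generic_mx /values /pencil_value.
by case: slot_point => [[x y] z] /=; rewrite !mevalC.
Qed.

Hypothesis r_ge2 : (2 <= r)%N.

Let i1_neq0 : i1 != ord0.
Proof. by rewrite -val_eqE /= inordK // ltnS ltnW. Qed.

Let gt1P (i : 'I_r.+1) : (1 < i)%N = (i != ord0) && (i != i1).
Proof.
have i1E : i1 = 1%N :> nat by rewrite inordK // ltnS ltnW.
by rewrite -!val_eqE /= i1E; case: i => [[|[|j]] ?].
Qed.

(** The right hand sides depend on [A] alone, so the entries of all normal forms satisfy the same
    univariate equations. *)
Lemma normal_presentation (A B : mxtuple k n r) :
  good_poly.@[coords A] != 0 -> symm_presentation A B ->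
  exists C : mxtuple k n r, [/\ tuple_equiv C B, forall i, (C i)^T = C i,
    C ord0 = 1%:M &
    exists2 d : 'rV[k]_n, C i1 = diag_mx d &
      forall (i : 'I_r.+1), (1 < i)%N -> forall w,
        slot_value id l (normal_slot c (\det (A ord0)) d (C i)) w =
        pencil_value id l c (A ord0) (A i1) (A i) w].
Proof.
rewrite meval_good_poly !mulf_eq0 !negb_or => /andP[/andP[A0 dA] _] [sB [e e0 BA]].
have detE (i : 'I_r.+1) x y z : (1 < i)%N -> \det (x *: B ord0 + y *: B i1 + z *: B i) =
    e * \det (x *: A ord0 + y *: A i1 + z *: A i).
  rewrite gt1P => /andP[i0 ii1].
  by rewrite -!sum_three_terms // -!meval_det_form BA mevalZ.
pose i2 : 'I_r.+1 := inord 2.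
have i2_gt1 : (1 < i2)%N by rewrite inordK.
have detE2 x y : \det (x *: B ord0 + y *: B i1) = e * \det (x *: A ord0 + y *: A i1).
  by have := detE i2 x y 0 i2_gt1; rewrite !scale0r !addr0.
have detE1 : \det (B ord0) = e * \det (A ord0).
  by have := detE2 1 0; rewrite !scale0r !addr0 !scale1r.
have B0 : \det (B ord0) != 0 by rewrite detE1 mulf_neq0.
have uA : A ord0 \in unitmx by rewrite unitmxE unitfE.
have uB : B ord0 \in unitmx by rewrite unitmxE unitfE.
have sepA : separable_poly (char_poly (A i1 *m invmx (A ord0))).
  by apply: (char_discr_scale_separable A0); rewrite scale_mul_invmx.
(* At t they are det (t B_0 - B_1) / det B_0 and det (t A_0 - A_1) / det A_0; the scalar [e]
   cancels. *)
have cpE : char_poly (B i1 *m invmx (B ord0)) = char_poly (A i1 *m invmx (A ord0)).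
  apply/eqP; rewrite -subr_eq0; apply/eqP/poly_eq0_horner => t.
  apply: (mulIf B0); rewrite mul0r hornerD hornerN mulrBl char_poly_pencil //.
  rewrite detE1 mulrCA char_poly_pencil // -!scaleN1r detE2 subrr //.
have [|P [d [uP PB0 PB1]]] := symmetric_pencil_normal_form (sB ord0) (sB i1) uB.
  by rewrite cpE.
pose C : mxtuple k n r := [ffun i => P *m B i *m P^T].
have sC i : (C i)^T = C i by rewrite ffunE !trmx_mul trmxK sB mulmxA.
exists C; split; [| exact: sC | |].
- apply: tuple_equiv_sym; exists P^T; first by rewrite unitmx_tr.
  by move=> i; rewrite ffunE trmxK.
- by rewrite ffunE.
exists d; first by rewrite ffunE.
move=> i i_gt1 w; apply: pencil_value_normal => // x y z.
have -> : x%:M + y *: diag_mx d + z *: C i =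
    P *m (x *: B ord0 + y *: B i1 + z *: B i) *m P^T.
  rewrite ffunE !mulmxDr !mulmxDl -!scalemxAr -!scalemxAl PB0 PB1.
  by rewrite scalemx1.
rewrite !det_mulmx detE // det_tr.
(* This fixes the scalar: (det P)^2 e det A_0 = 1. *)
have : \det P * \det (B ord0) * \det P = 1.
  by rewrite -[X in _ * X]det_tr -!det_mulmx PB0 det1.
rewrite detE1 => PAP.
rewrite -[LHS]mul1r -PAP; set D := \det (_ + _).
by rewrite -!mulrA !(mulrCA _ (\det (A ord0))) [\det P * D]mulrC.
Qed.

(** 0 and 1 account for the identity matrix and for the off-diagonal part of B_1. *)
Let entries (A : mxtuple k n r) : seq k :=
  [:: 0, 1 & flatten [seq poly_roots (map_poly (meval (values A p.1)) (g p.2))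
                     | p <- enum {: 'I_r.+1 * slot n}]].

Lemma normal_presentation_entries (A B : mxtuple k n r) :
  good_poly.@[coords A] != 0 -> symm_presentation A B ->
  exists2 C : mxtuple k n r, tuple_equiv C B &
    forall i a b, C i a b \in entries A.
Proof.
move=> gA BA; have [C [CB sC C0 [d C1 Cval]]] := normal_presentation gA BA.
exists C => //.
have Cin (i : 'I_r.+1) w : (1 < i)%N ->
    normal_slot c (\det (A ord0)) d (C i) w \in entries A.
  move=> i_gt1; rewrite !inE; apply/orP; right; apply/orP; right.
  apply/flattenP; eexists; first by apply: (map_f _ (x := (i, w))); rewrite mem_enum.
  set v := normal_slot _ _ _ _; apply: mem_poly_roots => /=.
    apply: lead_coef_map_neq0.
    move: gA; rewrite meval_good_poly mulf_eq0 negb_or => /andP[_].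
    by move=> /prodf_neq0/(_ i i_gt1)/prodf_neq0/(_ w isT).
  rewrite (_ : map_poly _ (g w) = map_poly (meval (slot_values l v)) (g w)) //.
  apply/polyP => j; rewrite !coef_map /=; apply: meval_eq => j'.
  by rewrite /slot_values Cval.
move=> i a b; have [->|i0] := eqVneq i ord0.
  by rewrite C0 mxE; case: eqP; rewrite !inE eqxx ?orbT.
have [->|ii1] := eqVneq i i1.
  rewrite C1 mxE; case: eqVneq => _; last by rewrite !inE eqxx.
  (* The diagonal of B_1 enters the equations of every i >= 2; i = 2 exists because r >= 2. *)
  rewrite mulr1n; apply: (Cin (inord 2) (Some (inl a))).
  by rewrite inordK.
have i_gt1 : (1 < i)%N by rewrite gt1P i0.
have [ab|/ltnW ab] := leqP a b.
  by have := Cin i (Some (inr (a, b))) i_gt1; rewrite /= ltnNge ab.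
by rewrite -sC mxE; have := Cin i (Some (inr (b, a))) i_gt1; rewrite /= ltnNge ab.
Qed.

Lemma finitely_many_presentations (A : mxtuple k n r) :
  good_poly.@[coords A] != 0 ->
  exists s : seq (mxtuple k n r), forall B, symm_presentation A B <->
    exists2 C, C \in s & tuple_equiv C B.
Proof.
move=> gA.
have A0 : \det (A ord0) != 0.
  by move: gA; rewrite meval_good_poly !mulf_eq0 !negb_or -andbA => /andP[].
(* A decidable form of [symm_presentation A C]: evaluation at (1, 0, ..., 0) forces the scalar to be
   det C_0 / det A_0. *)
pose pres (C : mxtuple k n r) := [&& [forall i, (C i)^T == C i], \det (C ord0) != 0 &
  det_form C == (\det (C ord0) / \det (A ord0)) *: det_form A].
have presP C : reflect (symm_presentation A C) (pres C).
  have det0 (M : mxtuple k n r) : (det_form M).@[fun i => (i == ord0)%:R] = \det (M ord0).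
    rewrite meval_det_form (bigD1 ord0) //= scale1r big1 ?addr0 // => i /negPf->.
    by rewrite scale0r.
  apply: (iffP and3P) => [[/forallP sC C0 /eqP CA]|[sC [e e0 CA]]].
    split=> [i|]; first exact/eqP.
    by exists (\det (C ord0) / \det (A ord0)); rewrite // mulf_neq0 ?invr_neq0.
  have CE : \det (C ord0) = e * \det (A ord0) by rewrite -!det0 CA mevalZ.
  split; first by apply/forallP => i; apply/eqP.
    by rewrite CE mulf_neq0.
  by rewrite CE mulfK // CA.
(* Tuples with entries in the list are coded by positions in it, which range over a finite type. *)
pose cand (t : {ffun 'I_r.+1 * 'I_n * 'I_n -> 'I_(size (entries A))}) : mxtuple k n r :=
  [ffun i => \matrix_(a, b) (entries A)`_(t (i, a, b))].
exists [seq C <- map cand (enum predT) | pres C] => B; split=> [BA|[C]]; last first.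
  by rewrite mem_filter => /andP[/presP CA _] CB; apply: symm_presentation_equiv CB CA.
have [C CB Cin] := normal_presentation_entries gA BA.
exists C => //; rewrite mem_filter; apply/andP; split.
  by apply/presP; apply: symm_presentation_equiv BA; apply: tuple_equiv_sym.
have Clt (p : 'I_r.+1 * 'I_n * 'I_n) :
  (index (C p.1.1 p.1.2 p.2) (entries A) < size (entries A))%N by rewrite index_mem.
apply/mapP; exists [ffun p => Ordinal (Clt p)]; first by rewrite mem_enum.
by apply/ffunP => i; apply/matrixP => a b; rewrite ffunE mxE ffunE /= nth_index.
Qed.

(** The witness is a multiple of the normal form described by [v], with the same matrix for all i >=
    2; its values are then [slot_values l v]. *)
Lemma good_poly_neq0 (v : slot n -> k) :
  c =1 v -> 1 + v None != 0 -> injective (slot_diag v) ->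
  (forall w, (lead_coef (g w)).@[slot_values l v] != 0) ->
  exists2 A : mxtuple k n r, symm_tuple A & good_poly.@[coords A] != 0.
Proof.
move=> cv v0 vinj gv.
(* An n-th root of the scaling factor, so that scaling the matrices by [rho] multiplies the
   determinants by 1 + v None. *)
have /closed_rootP[rho] : size ('X^n - (1 + v None)%:P) != 1%N by rewrite size_XnsubC.
rewrite /root hornerD hornerN hornerXn hornerC subr_eq0 => /eqP rhoE.
pose d := \row_a slot_diag v a.
pose A : mxtuple k n r := [ffun i => rho *: (if i == ord0 then 1%:M
  else if i == i1 then diag_mx d else \matrix_(a, b) slot_symm v a b)].
have detA0 : \det (A ord0) = 1 + v None.
  by rewrite ffunE eqxx scalemx1 det_scalar rhoE.
exists A.
  move=> i; rewrite ffunE linearZ /=; congr (_ *: _).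
  case: ifP => _; first exact: trmx1.
  case: ifP => _; first exact: tr_diag_mx.
  by apply/matrixP => a b; rewrite !mxE slot_symmC.
rewrite meval_good_poly mulf_neq0 //; first apply: mulf_neq0; rewrite ?detA0 //.
  have -> : A i1 *m \adj (A ord0) = diag_mx ((1 + v None) *: d).
    rewrite ffunE (negPf i1_neq0) eqxx -scalemxAl.
    have -> : rho *: (diag_mx d *m \adj (A ord0)) =
        diag_mx d *m (A ord0 *m \adj (A ord0)).
      by rewrite ffunE eqxx -scalemxAl mul1mx scalemxAr.
    by rewrite mul_mx_adj detA0 mul_mx_scalar linearZ.
  apply: char_discr_diag => a b; rewrite !mxE => /(mulfI v0); exact: vinj.
apply/prodf_neq0 => i; rewrite gt1P => /andP[/negPf i0 /negPf ii1].
apply/prodf_neq0 => w _; rewrite (_ : _.@[_] = (lead_coef (g w)).@[slot_values l v]) //.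
apply: meval_eq => j; rewrite /values /slot_values; move: (enum_val j) => {}w.
rewrite /pencil_value /slot_value; case: ifP => [_|_]; first exact: cv.
rewrite /= detA0; case: eqP => [->|_]; first by rewrite addrC addKr.
case: slot_point => [[x y] z]; rewrite -rhoE -detZ; congr (\det _).
apply/matrixP => a b; rewrite !ffunE eqxx (negPf i1_neq0) eqxx i0 ii1 !mxE.
rewrite /d; case: eqVneq => [->|_]; rewrite ?mulr1n ?mulr0n ?mulr0 ?mulr1 ?add0r.
  by rewrite mulrDr mulrDr mulrCA [x * rho]mulrC [z * _]mulrCA.
by rewrite mulrCA.
Qed.

End Finiteness.

Theorem theorem2 (k : closedFieldType) (hk : 2%N \notin [pchar k])
    (n r : nat) (hn : (1 <= n)%N) (hr : (2 <= r)%N) :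
  exists U : mxtuple k n r -> Prop,
    [/\ zariski_open_symm U,
        exists A, U A
      & forall A, U A ->
          exists s : seq (mxtuple k n r),
            forall B, symm_presentation A B <->
              exists2 C, C \in s & tuple_equiv C B].
Proof.
case: n hn => // m _.
have [l l_inj] := closed_field_injection k m.+1.
have [g g0 gP] : exists2 g : slot m.+1 -> {poly {mpoly k[#|slot m.+1|]}},
    forall w, g w != 0 &
    forall w v, root (map_poly (meval (slot_values l v)) (g w)) (v w).
  apply: (@fin_all_exists2 _ (fun=> {poly {mpoly k[#|slot m.+1|]}})
    (fun w g => g != 0)
    (fun w g => forall v, root (map_poly (meval (slot_values l v)) g) (v w))) => w.
  exact: slot_relation.
pose X (w : slot m.+1) : {mpoly k[#|slot m.+1|]} := 'X_(enum_rank w).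
have X_inj : injective X.
  move=> w w' /(congr1 (fun p => p@_U_(enum_rank w)%MM)).
  rewrite !mcoeffXU eqxx; case: eqP => [/enum_rank_inj-> //|_ /eqP].
  by rewrite oner_eq0.
(* The first polynomial constrains the equations, where that of [None] is the unknown itself; the
   second makes the diagonal entries of [v] distinct. *)
have [||v [gv qv]] := @slot_values_dense k m.+1 l
    ((1 + X None) * \prod_w lead_coef (g w))
    (\prod_a \prod_(b | b != a) (X (Some (inl b)) - X (Some (inl a)))) l_inj.
- apply: mulf_neq0; last by apply/prodf_neq0 => w _; rewrite lead_coef_eq0.
  apply/eqP => /(congr1 (meval (fun=> 0))).
  rewrite mevalD meval1 mevalXU meval0 addr0 => /eqP.
  by rewrite oner_eq0.
- apply/prodf_neq0 => a _; apply/prodf_neq0 => b ba.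
  by rewrite subr_eq0 (inj_eq X_inj) /=; apply: contraNneq ba => -[->].
(* The dummies get their constants from [v], so that the values at the witness agree with those of
   [v] in every slot. *)
have [A sA pA] : exists2 A : mxtuple k m.+1 r, symm_tuple A &
    (good_poly r l g v).@[coords A] != 0.
  move: gv; rewrite mevalM mulf_eq0 negb_or mevalD meval1 mevalXU => /andP[v0 gv].
  apply: (good_poly_neq0 hr (v := v)) => //.
  - by rewrite /slot_values enum_rankK in v0.
  - move=> a b vab; apply/eqP; apply: contraNT qv => ba.
    rewrite rmorph_prod (bigD1 b) //= rmorph_prod (bigD1 a) //=.
    by rewrite mevalB !mevalXU !enum_rankK -!/(slot_diag v _) vab subrr !mul0r.
  move=> w; move: gv; rewrite rmorph_prod => /prodf_neq0/(_ w isT).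
  by [].
exists (fun A => symm_tuple A /\ (good_poly r l g v).@[coords A] != 0); split.
- exists (fun p => p = good_poly r l g v) => A'; split=> -[sA' pA']; split=> //.
    by exists (good_poly r l g v).
  by case: pA' => _ ->.
- by exists A.
by move=> A' [_ pA']; apply: (finitely_many_presentations gP hr pA').
Qed.
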